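(* Let $C_{\mathsf{MSE}}>0$. There exist constants $C_{\mathsf{high}}>0$, $c_{\mathrm{high}}>0$ and $N_0$, depending only on $C_{\mathsf{MSE}}$, such that for all $d\ge1$, all $n\ge N_0$, every measurable $f\colon(\mathbb R^d)^n\to\mathbb R^d$ that is $(C_{\mathsf{MSE}},\frac dn)$-uniformly MSE-accurate for $\{\mathcal N(\mu,\mathbb I_d)\}_{\mu\in\mathbb R^d}$, and every $\eta\in(0,\frac1{10})$ with $\lfloor\eta n\rfloor\ge C_{\mathsf{high}}\log n$, we have \[\sup_{\mu\in\mathbb R^d}\mathsf{ES}_{\eta,2}(f;\mu)\ge c_{\mathrm{high}}\,\eta.\]
   Context: For datasets $x,x'\in(\mathbb R^d)^n$, $d_H(x,x')=\#\{i\in[n]: x_i\neq x_i'\}$. For $f\colon(\mathbb R^d)^n\to\mathbb R^d$ and $\eta\in(0,1)$, $S^f_\eta(X)=\sup_{X'\colon d_H(X,X')\le\lfloor\eta n\rfloor}\|f(X)-f(X')\|_2$, and for $q\in\{1,2\}$, $\mathsf{ES}_{\eta,q}(f;\mu)=\big(\mathbb E_{X\sim\mathcal N(\mu,\mathbb I_d)^{\otimes n}}[S^f_\eta(X)^q]\big)^{1/q}$. $f$ is $(C_{\mathsf{MSE}},\frac dn)$-uniformly MSE-accurate if $\sup_{\mu\in\mathbb R^d}\mathbb E_{X\sim\mathcal N(\mu,\mathbb I_d)^{\otimes n}}\|f(X)-\mu\|_2^2\le C_{\mathsf{MSE}}\frac dn$. *)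

(* Defs.v *)
From HB Require Import structures.
From mathcomp Require Import all_boot all_order all_algebra.
From mathcomp Require Import all_classical all_reals all_analysis.
Set Implicit Arguments. Unset Strict Implicit. Unset Printing Implicit Defensive.
Import Order.TTheory GRing.Theory Num.Theory.
Local Open Scope ring_scope.

Section defs.
Variable R : realType.

Definition l2dist (d : nat) (x y : d.-tuple R) : R :=
  Num.sqrt (\sum_(i < d) (tnth x i - tnth y i) ^+ 2).

Definition dH (T : eqType) (n : nat) (X X' : n.-tuple T) : nat :=
  #|[set i : 'I_n | tnth X i != tnth X' i]|.

(* Iterated expectation w.r.t. a product of one-dimensional "expectation
   functionals" Es: E_1 (fun x1 => E_2 (fun x2 => ... g [:: x1; x2; ...])). *)
Fixpoint prodE (T : Type) (Es : seq ((T -> \bar R) -> \bar R))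
    (g : seq T -> \bar R) : \bar R :=
  match Es with
  | [::] => g [::]
  | E :: Es' => E (fun x => prodE Es' (fun s => g (x :: s)))
  end.

(* Expectation of h(Z) for Z ~ N(mu, I_d): product of the one-dimensional
   normal laws N(mu_i, 1) (library's normal_prob, standard deviation 1),
   as an iterated Lebesgue integral. *)
Definition gaussE (d : nat) (mu : d.-tuple R) (h : d.-tuple R -> \bar R)
    : \bar R :=
  prodE [seq (fun k : R -> \bar R => (\int[normal_prob m 1]_x k x)%E) | m <- mu]
        (fun s => h (insubd mu s)).

Definition dataE (d n : nat) (mu : d.-tuple R)
    (g : n.-tuple (d.-tuple R) -> \bar R) : \bar R :=
  prodE (nseq n (gaussE mu)) (fun s => g (insubd [tuple of nseq n mu] s)).

Definition Sens (d n : nat) (f : n.-tuple (d.-tuple R) -> d.-tuple R)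
    (eta : R) (X : n.-tuple (d.-tuple R)) : \bar R :=
  ereal_sup [set (l2dist (f X) (f X'))%:E | X' in
     [set X' : n.-tuple (d.-tuple R) | ((dH X X')%:Z <= Num.floor (eta * n%:R))%R]].

Definition sqrte (x : \bar R) : \bar R :=
  match x with
  | r%:E => (Num.sqrt r)%:E
  | +oo%E => +oo%E
  | -oo%E => 0%E
  end.

Definition ES2 (d n : nat) (f : n.-tuple (d.-tuple R) -> d.-tuple R)
    (eta : R) (mu : d.-tuple R) : \bar R :=
  sqrte (@dataE d n mu (fun X => (Sens f eta X ^+ 2)%E)).

Definition unif_MSE_accurate (d n : nat)
    (f : n.-tuple (d.-tuple R) -> d.-tuple R) (C : R) : Prop :=
  (ereal_sup [set @dataE d n mu (fun X => ((l2dist (f X) mu) ^+ 2)%:E) | mu in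
     [set: d.-tuple R]] <= (C * d%:R / n%:R)%:E)%E.

End defs.

(* Main.v *)
(* Proof idea. Let k be the integer part of eta n and delta = k / (8 n). Couple
   N(mu, I_d)^n with N(mu + delta e_j, I_d)^n by coupling the j-th coordinates
   of the n points by reflection, the maximal coupling of two Gaussians: each
   point moves with probability O(delta), so by Chernoff's bound at most k
   points move outside an event of probability e^(-k/4) <= n^(-3). On the good
   event the coordinate f_j changes by at most the sensitivity, and on the bad
   event the mean square errors of f_j at mu and at mu + delta e_j control the
   change. Hence if the sensitivity were small, the mean of max(0, f_j) would
   grow by much less than delta along each such step, up to a multiple of the
   two errors. Summing over all axis-parallel lines of a large grid of means and
   over all directions j, the errors sum up to the total error of f, at most
   C d / n per grid point, so that the bound does not depend on d; but by
   accuracy at its two end points the mean of max(0, f_j) does grow by delta per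
   step along a line, up to a constant. *)
Require Import Defs.
From HB Require Import structures.
From mathcomp Require Import all_boot all_order all_algebra.
From mathcomp Require Import all_classical all_reals all_analysis.
From mathcomp Require Import measurable_realfun ring lra.
Import Order.TTheory GRing.Theory Num.Theory.
Local Open Scope classical_set_scope.
Local Open Scope ring_scope.

(** * Expectation functionals *)

Section Expectation.
Context {R : realType}.
Local Open Scope ereal_scope.

(* Monotonicity is required of arbitrary functions because the sensitivity,
   a supremum over an uncountable family, need not be measurable. *)
Record is_expectation {d} {T : measurableType d} (E : (T -> \bar R) -> \bar R)
    : Prop := {
  expect_le : forall f g : T -> \bar R, (forall x, 0 <= f x) ->
    (forall x, f x <= g x) -> E f <= E g ;
  expectD : forall f g : T -> \bar R,
    measurable_fun [set: T] f -> (forall x, 0 <= f x) ->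
    measurable_fun [set: T] g -> (forall x, 0 <= g x) ->
    E (fun x => f x + g x) = E f + E g ;
  expectZ : forall (r : R) (f : T -> \bar R), (0 <= r)%R ->
    measurable_fun [set: T] f -> (forall x, 0 <= f x) ->
    E (fun x => r%:E * f x) = r%:E * E f ;
  expect1 : E (fun=> 1) = 1 ;
  expect_measurable : forall d' (S : measurableType d') (F : S * T -> \bar R),
    measurable_fun [set: S * T] F -> (forall z, 0 <= F z) ->
    measurable_fun [set: S] (fun s => E (fun x => F (s, x))) }.

Section ExpectationTheory.
Context {d} {T : measurableType d} {E : (T -> \bar R) -> \bar R}.
Hypothesis EE : is_expectation E.

Lemma expect_cst (r : R) : (0 <= r)%R -> E (fun=> r%:E) = r%:E.
Proof.
move=> r0; have := expectZ _ EE r (fun=> 1) r0 (measurable_cst _).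
by rewrite expect1// !mule1 => -> // x; exact: lee01.
Qed.

Lemma expect_ge0 f : (forall x, 0 <= f x) -> 0 <= E f.
Proof.
move=> f0; have <- : E (fun=> 0) = 0 by exact: expect_cst.
exact: (expect_le _ EE).
Qed.

End ExpectationTheory.

Import HBNNSimple.

(** The integral of a nonnegative function is a supremum over the simple functions below it, and a
    larger function has more of them. This covers non-measurable [f] and [g]. *)
Lemma le_ge0_integral d (T : measurableType d) (mu : {measure set T -> \bar R})
    (f g : T -> \bar R) : (forall x, 0 <= f x) -> (forall x, f x <= g x) ->
  \int[mu]_x f x <= \int[mu]_x g x.
Proof.
move=> f0 fg; have g0 x : 0 <= g x by exact: le_trans (fg x).
rewrite !ge0_integralTE//; apply: ereal_sup_le => _ [h hf <-].
by exists h => // x; exact: le_trans (fg x).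
Qed.

Lemma is_expectation_integral d (T : measurableType d) (P : probability T R) :
  is_expectation (fun h => \int[P]_x h x).
Proof.
split.
- exact: le_ge0_integral.
- by move=> f g mf f0 mg g0; rewrite ge0_integralD.
- by move=> r f r0 mf f0; rewrite ge0_integralZl.
- by rewrite integral_cst//= probability_setT mule1.
- move=> d' S F mF F0.
  exact: (@measurable_fun_fubini_tonelli_F _ _ S T R P F mF F0).
Qed.

End Expectation.

(** * Iterated expectations over tuples *)

Section TupleExpectation.
Context {R : realType}.
Local Open Scope ereal_scope.

(** A form of [prodE] with lengths tracked by types and one functional per entry of a tuple of
    parameters. It serves alike for a Gaussian vector, for a data set and for their couplings. *)
Fixpoint tupE {I T : Type} (K : I -> (T -> \bar R) -> \bar R) {n : nat} :
    n.-tuple I -> (n.-tuple T -> \bar R) -> \bar R :=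
  match n with
  | 0 => fun _ h => h [tuple]
  | n.+1 => fun t h =>
      K (thead t)
        (fun x => tupE K (behead_tuple t) (fun s => h [tuple of x :: s]))
  end.

(** Only sequences of length [n] ever reach [h], so the default [t0] of [insubd] never shows. *)
Lemma prodE_tupE {I T : Type} (K : I -> (T -> \bar R) -> \bar R) n
    (t : n.-tuple I) (t0 : n.-tuple T) (h : n.-tuple T -> \bar R) :
  prodE [seq K i | i <- t] (fun s => h (insubd t0 s)) = tupE K t h.
Proof.
have prodE_eq Es g g' : (forall s : seq T, size s = size Es -> g s = g' s) ->
    prodE Es g = prodE Es g' :> \bar R.
  elim: Es g g' => [|E Es IH] g g' gg' /=; first exact: gg'.
  by congr E; apply/funext => x; apply: IH => s sE; apply: gg'; rewrite /= sE.
elim: n t t0 h => [|n IH] t t0 h.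
  by rewrite (tuple0 t) /=; congr h; exact: tuple0.
case/tupleP: t => i t; rewrite /= theadE; congr (K i); apply/funext => x.
have -> : behead_tuple [tuple of i :: t] = t by exact: val_inj.
rewrite -(IH _ (behead_tuple t0)); apply: prodE_eq => s.
rewrite size_map size_tuple => sn; congr h; apply: val_inj.
by rewrite val_insubd /= eqSS sn eqxx /= val_insubd sn eqxx.
Qed.

Section Measurable.
Context {I : Type} {d} {T : measurableType d}.
Variable K : I -> (T -> \bar R) -> \bar R.
Hypothesis KE : forall i, is_expectation (K i).

Lemma measurable_fun_cons d' (S : measurableType d') n
    (f : S * n.+1.-tuple T -> \bar R) : measurable_fun setT f ->
  measurable_fun setT (fun z : (S * T) * n.-tuple T =>
    f (z.1.1, [tuple of z.1.2 :: z.2])).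
Proof.
move=> mf; apply: (measurableT_comp mf); apply/measurable_fun_pair => /=.
  by apply: measurableT_comp => //; exact: measurable_fst.
by apply: measurable_cons => //; apply: measurableT_comp.
Qed.

(** Induction on the length. The clause [expect_measurable], with its free parameter space, makes
    the inner expectation a measurable function of the first entry, as the linearity clauses of the
    outer functional demand. *)
Lemma tupE_is_expectation n (t : n.-tuple I) : is_expectation (tupE K t).
Proof.
have mcons m (f : m.+1.-tuple T -> \bar R) : measurable_fun setT f ->
    measurable_fun setT (fun z : T * m.-tuple T => f [tuple of z.1 :: z.2]).
  by move=> mf; apply: (measurableT_comp mf); exact: measurable_cons.
have msec m (f : m.+1.-tuple T -> \bar R) x : measurable_fun setT f ->
    measurable_fun setT (fun s : m.-tuple T => f [tuple of x :: s]).
  by move=> mf; apply: (measurableT_comp mf); exact: measurable_cons.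
elim: n t => [|n IH] t.
  split => //=.
  by move=> d' S F mF _; exact: (measurableT_comp mF).
have {}IH := IH (behead_tuple t); have KEt := KE (thead t).
have mE f : measurable_fun setT f -> (forall x, 0 <= f x) ->
    measurable_fun setT
      (fun x => tupE K (behead_tuple t) (fun s => f [tuple of x :: s])).
  by move=> mf f0; exact: (expect_measurable _ IH _ _ _ (mcons n f mf)).
split => /=.
- move=> f g f0 fg; apply: (expect_le _ KEt) => x.
    by apply: (expect_ge0 IH).
  exact: (expect_le _ IH).
- move=> f g mf f0 mg g0; rewrite -(expectD _ KEt); last 4 first.
  + exact: mE.
  + by move=> x; apply: (expect_ge0 IH).
  + exact: mE.
  + by move=> x; apply: (expect_ge0 IH).
  congr (K _); apply/funext => x.
  by rewrite -(expectD _ IH)//; exact: msec.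
- move=> r f r0 mf f0; rewrite -(expectZ _ KEt)//; last 2 first.
  + exact: mE.
  + by move=> x; apply: (expect_ge0 IH).
  congr (K _); apply/funext => x.
  by rewrite -(expectZ _ IH)//; exact: msec.
- rewrite -[RHS](expect1 _ KEt); congr (K _); apply/funext => x.
  exact: expect1 IH.
- move=> d' S F mF F0.
  apply: (expect_measurable _ KEt d' S (fun z => tupE K (behead_tuple t)
    (fun s => F (z.1, [tuple of z.2 :: s])))).
    apply: (expect_measurable _ IH _ _ _ (measurable_fun_cons _ _ _ _ mF)).
    by move=> z.
  by move=> z; exact: (expect_ge0 IH).
Qed.

(** Independence: the factors of the other entries are constants for the first one and are pulled
    out by homogeneity. *)
Lemma tupE_prod (g : T -> R) (c : I -> R) :
  measurable_fun [set: T] g ->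
  (forall x, 0 <= g x)%R -> (forall i, 0 <= c i)%R ->
  (forall i, K i (fun x => (g x)%:E) = (c i)%:E) ->
  forall n (t : n.-tuple I),
  tupE K t (fun s => (\prod_(i < n) g (tnth s i))%:E) =
    (\prod_(i < n) c (tnth t i))%:E.
Proof.
move=> mg g0 c0 Kg; elim=> [|n IH] t; first by rewrite /= !big_ord0.
case/tupleP: t => j t; have KEt := tupE_is_expectation n t.
rewrite /= theadE big_ord_recl/=.
have -> : behead_tuple [tuple of j :: t] = t by exact: val_inj.
transitivity (K j (fun x => (\prod_(i < n) c (tnth t i))%:E * (g x)%:E)).
  congr (K _); apply/funext => x; rewrite -IH.
  rewrite muleC -(expectZ _ KEt)//; last 2 first.
  - apply/measurable_EFinP; apply: measurable_prod => i _.
    by apply: (measurableT_comp mg); exact: measurable_tnth.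
  - by move=> s; rewrite lee_fin prodr_ge0.
  congr (tupE K _); apply/funext => s; rewrite -EFinM big_ord_recl; congr (_ * _)%:E.
  by apply: eq_bigr => i _; rewrite tnthS.
rewrite (expectZ _ (KE _)) ?Kg; last 3 first.
- by rewrite prodr_ge0.
- exact/measurable_EFinP.
- by move=> x; rewrite lee_fin.
rewrite -EFinM mulrC; congr (_ * _)%:E.
by apply: eq_bigr => i _; rewrite tnthS.
Qed.

End Measurable.

(** Transport of a product law along a coordinatewise map. Here [h] is arbitrary because the first
    marginal of the coupling is applied to the squared sensitivity. *)
Lemma tupE_map {I J V T : Type} (a : I -> J) (phi : V -> T)
    (KV : I -> (V -> \bar R) -> \bar R) (K : J -> (T -> \bar R) -> \bar R) :
  (forall i h, KV i (fun v => h (phi v)) = K (a i) h) ->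
  forall n (t : n.-tuple I) h,
  tupE KV t (fun s => h (map_tuple phi s)) = tupE K (map_tuple a t) h.
Proof.
move=> KVK; elim=> [|n IH] t h; first by rewrite /=; congr h; exact: val_inj.
case/tupleP: t => i t; rewrite /= !theadE -KVK.
have -> : behead_tuple [tuple of i :: t] = t by exact: val_inj.
have -> : behead_tuple (map_tuple a [tuple of i :: t]) = map_tuple a t.
  exact: val_inj.
congr (KV i); apply/funext => v; rewrite -IH; congr (tupE KV _).
by apply/funext => s; congr h; exact: val_inj.
Qed.

(** The variant for the second marginal of the coupling, whose one-point identity comes from a
    change of variables for measurable nonnegative functions. *)
Lemma tupE_map_measurable {I J V : Type} d (T : measurableType d) (a : I -> J)
    (phi : V -> T) (KV : I -> (V -> \bar R) -> \bar R)
    (K : J -> (T -> \bar R) -> \bar R) :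
  (forall j, is_expectation (K j)) ->
  (forall i h, measurable_fun [set: T] h -> (forall x, 0 <= h x) ->
    KV i (fun v => h (phi v)) = K (a i) h) ->
  forall n (t : n.-tuple I) h, measurable_fun [set: n.-tuple T] h ->
    (forall s, 0 <= h s) ->
  tupE KV t (fun s => h (map_tuple phi s)) = tupE K (map_tuple a t) h.
Proof.
move=> KE KVK; elim=> [|n IH] t h mh h0.
  by rewrite /=; congr h; exact: val_inj.
case/tupleP: t => i t; rewrite /= !theadE.
have -> : behead_tuple [tuple of i :: t] = t by exact: val_inj.
have -> : behead_tuple (map_tuple a [tuple of i :: t]) = map_tuple a t.
  exact: val_inj.
rewrite -KVK; last 2 first.
- apply: (expect_measurable _ (tupE_is_expectation K KE _ _) _ _
    (fun z => h [tuple of z.1 :: z.2])) => //.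
  by apply: (measurableT_comp mh); exact: measurable_cons.
- by move=> x; exact: (expect_ge0 (tupE_is_expectation K KE _ _)).
congr (KV i); apply/funext => v; rewrite -IH//; last first.
  by apply: (measurableT_comp mh); exact: measurable_cons.
congr (tupE KV _); apply/funext => s; congr h; exact: val_inj.
Qed.

End TupleExpectation.

(** * Densities and reflections *)

Section Density.
Context {d} {T : measurableType d} {R : realType}.
Variables (mu nu : {measure set T -> \bar R}) (p : T -> R).
Hypothesis mp : measurable_fun [set: T] p.
Hypothesis p0 : forall x, 0 <= p x.
Hypothesis nuE : forall A, measurable A -> nu A = (\int[mu]_(x in A) (p x)%:E)%E.

Import HBNNSimple.
Local Open Scope ereal_scope.

(** A simple function is a finite combination of indicators of its fibres, on which [nuE]
    applies. *)
Lemma integral_density_nnsfun (f : {nnsfun T >-> R}) :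
  \int[nu]_x (f x)%:E = \int[mu]_x ((f x)%:E * (p x)%:E).
Proof.
have mpE : measurable_fun [set: T] (fun x => (p x)%:E) by exact/measurable_EFinP.
under [LHS]eq_integral do rewrite fimfunE -fsumEFin//.
rewrite [LHS]ge0_integral_fsum//; last 2 first.
  - by move=> r; exact/measurable_EFinP/measurableT_comp.
  - by move=> n x _; rewrite EFinM nnfun_muleindic_ge0.
under [RHS]eq_integral.
  move=> x xD; rewrite fimfunE -fsumEFin// muleC ge0_mule_fsumr; last first.
    by move=> r; rewrite EFinM nnfun_muleindic_ge0.
  over.
rewrite [RHS]ge0_integral_fsum//; last 2 first.
  - move=> r; apply: emeasurable_funM => //.
    by apply/measurable_EFinP; apply/measurableT_comp.
  - move=> n x _; rewrite EFinM mule_ge0//; last by rewrite nnfun_muleindic_ge0.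
    by rewrite lee_fin.
apply: eq_fsbigr => r /set_mem[x _ fxr].
have r0 : (0 <= r)%R by rewrite -fxr.
have mr : measurable (f @^-1` [set r]).
  by rewrite -[_ @^-1` _]setTI; exact: measurable_funP.
under [LHS]eq_integral do rewrite EFinM.
rewrite ge0_integralZl//; last exact/measurable_EFinP/measurable_indic.
under [RHS]eq_integral do rewrite EFinM muleCA.
rewrite ge0_integralZl//; last 2 first.
- by apply: emeasurable_funM => //; exact/measurable_EFinP/measurable_indic.
- by move=> y _; rewrite mule_ge0// lee_fin.
congr (_ * _); rewrite integral_indic// setIT nuE// integral_mkcond.
apply: eq_integral => y _; rewrite patchE indicE.
by case: ifP => _; rewrite ?mule1// mule0.
Qed.

Lemma integral_density (f : T -> \bar R) :
  measurable_fun [set: T] f -> (forall x, 0 <= f x) ->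
  \int[nu]_x f x = \int[mu]_x (f x * (p x)%:E).
Proof.
move=> mf f0; have mpE : measurable_fun [set: T] (fun x => (p x)%:E).
  exact/measurable_EFinP.
pose f_ := nnsfun_approx measurableT mf.
have cf x : (f_ n x)%:E @[n --> \oo] --> f x by exact: cvg_nnsfun_approx.
have ndf x m n : (m <= n)%N -> (f_ m x)%:E <= (f_ n x)%:E.
  by move=> mn; rewrite lee_fin; exact/lefP/nd_nnsfun_approx.
transitivity (limn (fun n => \int[nu]_x (f_ n x)%:E)).
  rewrite -monotone_convergence//=.
  - by apply: eq_integral => x _; apply/esym/cvg_lim => //; exact: cf.
  - by move=> n; exact/measurable_EFinP/measurable_funTS.
  - by move=> n x _; rewrite lee_fin.
  - by move=> x _ m n mn; exact: ndf.
transitivity (limn (fun n => \int[mu]_x ((f_ n x)%:E * (p x)%:E))).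
  by apply: congr_lim; apply/funext => n; exact: integral_density_nnsfun.
rewrite -monotone_convergence//=.
- apply: eq_integral => x _; apply/cvg_lim => //.
  by under eq_fun do rewrite muleC; rewrite muleC; apply: cvgeMl.
- by move=> n; apply: emeasurable_funM => //; exact/measurable_EFinP/measurable_funTS.
- by move=> n x _; rewrite mule_ge0// lee_fin.
- by move=> x _ m n mn; rewrite lee_pmul// ?lee_fin//; exact: ndf.
Qed.

End Density.

(** * Reflection invariance of Lebesgue measure *)

Section Reflection.
Context {R : realType}.
Notation mu := (@lebesgue_measure R).
Local Open Scope ereal_scope.

(** By uniqueness of Lebesgue measure it suffices to compare half-open intervals, and a reflection
    preserves their length while swapping the closed end. *)
Lemma lebesgue_measure_reflect (c : R) (A : set R) : measurable A ->
  pushforward mu ((fun x => c - x)%R : measurableTypeR R -> measurableTypeR R) A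
  = mu A.
Proof.
have mc : measurable_fun setT ((fun x => c - x)%R : measurableTypeR R -> R).
  exact: measurable_funB.
move=> mA.
apply/esym/lebesgue_measure_unique => //= _ [[a b]] _ <-.
rewrite /pushforward.
have -> : ((fun x => c - x)%R @^-1` `]a, b]%classic)
    = `[(c - b)%R, (c - a)%R[%classic.
  by apply/seteqP; split => x /=; rewrite !in_itv/=; lra.
rewrite !lebesgue_measure_itv/= !lte_fin.
have -> : (c - b < c - a)%R = (a < b)%R by apply/idP/idP; lra.
by case: ifP => // _; rewrite -!EFinB; congr (_%:E); lra.
Qed.

Lemma integral_reflect (c : R) (f : R -> \bar R) :
  measurable_fun [set: R] f -> (forall x, 0 <= f x) ->
  \int[mu]_x f (c - x)%R = \int[mu]_x f x.
Proof.
move=> mf f0.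
have mc : measurable_fun setT
    ((fun x => c - x)%R : measurableTypeR R -> measurableTypeR R).
  exact: measurable_funB.
rewrite [RHS](_ : _ = \int[pushforward mu
    ((fun x => c - x)%R : measurableTypeR R -> measurableTypeR R)]_x f x).
  by rewrite ge0_integral_pushforward//.
by apply: eq_measure_integral => //= A mA AS; exact/esym/lebesgue_measure_reflect.
Qed.

End Reflection.

(** * The reflection coupling *)

(** From [exp (- u) >= 1 - u] one gets [exp u <= 1 / (1 - u)], which is at most [1 + 2 u] for
    [u <= 1 / 2]. *)
Lemma expR_le1D2x {R : realType} (u : R) :
  0 <= u <= 1 / 2 -> expR u <= 1 + 2 * u.
Proof.
move=> /andP[u0 u1]; have := expR_ge1Dx (- u); rewrite expRN.
have := expR_gt0 u; move: (expR u) => e e0.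
by rewrite -(ler_pM2l e0) mulfV ?gt_eqF//; nra.
Qed.

Section GaussianShift.
Context {R : realType}.
Implicit Types (m delta x c : R) (h : R -> \bar R).

(** The likelihood ratio of N(m + delta, 1) to N(m, 1). *)
Definition lratio m delta x := expR (delta * (x - m) - delta ^+ 2 / 2).

Lemma measurable_lratio m delta : measurable_fun [set: R] (lratio m delta).
Proof.
apply: measurableT_comp => //; apply: measurable_funB => //.
by apply: measurable_funM => //; apply: measurable_funB.
Qed.

Lemma lratio_ge0 m delta x : 0 <= lratio m delta x.
Proof. exact: expR_ge0. Qed.

Lemma normal_pdf_shift m delta x :
  normal_pdf (m + delta) 1 x = lratio m delta x * normal_pdf m 1 x.
Proof.
rewrite !normal_pdfE ?oner_neq0// /normal_fun /lratio mulrCA; congr (_ * _).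
by rewrite -expRD; congr expR; field.
Qed.

Lemma normal_pdf_reflect m delta x :
  normal_pdf m 1 (2 * m + delta - x) = normal_pdf (m + delta) 1 x.
Proof.
rewrite !normal_pdfE ?oner_neq0// /normal_fun; congr (_ * _).
by congr expR; field.
Qed.

(** Reflection about the midpoint [m + delta / 2] swaps the two densities, hence inverts their
    ratio. *)
Lemma lratio_reflect m delta x :
  lratio m delta (2 * m + delta - x) = (lratio m delta x)^-1.
Proof. by rewrite /lratio -expRN; congr expR; field. Qed.

Lemma integral_normal_prob m h :
  measurable_fun [set: R] h -> (forall x, (0 <= h x)%E) ->
  (\int[normal_prob m 1]_x h x =
   \int[lebesgue_measure]_x (h x * (normal_pdf m 1 x)%:E))%E.
Proof.
move=> mh h0; apply: integral_density => //.
- exact: measurable_normal_pdf.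
- exact: normal_pdf_ge0.
Qed.

Lemma integral_normal_prob_shift m delta h :
  measurable_fun [set: R] h -> (forall x, (0 <= h x)%E) ->
  (\int[normal_prob (m + delta) 1]_x h x =
   \int[normal_prob m 1]_x ((lratio m delta x)%:E * h x))%E.
Proof.
move=> mh h0; rewrite (integral_normal_prob (m + delta) h)//.
rewrite (integral_normal_prob m (fun x => (lratio m delta x)%:E * h x)%E).
- apply: eq_integral => x _.
  by rewrite normal_pdf_shift EFinM muleCA muleA.
- by apply: emeasurable_funM => //; apply/measurable_EFinP; exact: measurable_lratio.
- by move=> x; rewrite mule_ge0// lee_fin lratio_ge0.
Qed.

(* [(1 - q / p)^+] for the densities [p] of N(m, 1) and [q] of N(m + delta, 1):
   the probability that the maximal coupling moves the point [x]. *)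
Definition moveP m delta x := Num.max 0 (1 - lratio m delta x).

Lemma measurable_moveP m delta : measurable_fun [set: R] (moveP m delta).
Proof.
apply: measurable_maxr => //; apply: measurable_funB => //.
exact: measurable_lratio.
Qed.

Lemma moveP_ge0 m delta x : 0 <= moveP m delta x.
Proof. by rewrite le_max lexx. Qed.

Lemma moveP_le1 m delta x : moveP m delta x <= 1.
Proof. by rewrite ge_max ler01 gerBl lratio_ge0. Qed.

Lemma moveP0 m x : moveP m 0 x = 0.
Proof. by rewrite /moveP /lratio mul0r expr0n/= mul0r subrr expR0 subrr maxxx. Qed.

(* Reflection coupling of N(m, 1) and N(m + delta, 1). *)
Definition reflE (p : R * R) (h : R * R -> \bar R) : \bar R :=
  (\int[normal_prob p.1 1]_x ((1 - moveP p.1 p.2 x)%:E * h (x, x) +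
     (moveP p.1 p.2 x)%:E * h (x, (2 * p.1 + p.2 - x)%R)))%E.

Local Open Scope ereal_scope.

Lemma reflE_is_expectation p : is_expectation (reflE p).
Proof.
case: p => m delta; rewrite /reflE/=.
have P0 x : 0 <= (moveP m delta x)%:E by rewrite lee_fin moveP_ge0.
have Q0 x : 0 <= (1 - moveP m delta x)%:E by rewrite lee_fin subr_ge0 moveP_le1.
have mP : measurable_fun [set: R] (fun x => (moveP m delta x)%:E).
  by apply/measurable_EFinP; exact: measurable_moveP.
have mQ : measurable_fun [set: R] (fun x => (1 - moveP m delta x)%:E).
  by apply/measurable_EFinP/measurable_funB => //; exact: measurable_moveP.
have mR : measurable_fun [set: R] (fun x => 2 * m + delta - x)%R.
  exact: measurable_funB.
have EI := is_expectation_integral _ _ (normal_prob m 1).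
have m1 (h : R * R -> \bar R) : measurable_fun setT h ->
    measurable_fun setT (fun x => (1 - moveP m delta x)%:E * h (x, x)).
  move=> mh; apply: emeasurable_funM => //.
  by apply: (measurableT_comp mh); exact: measurable_fun_pair.
have m2 (h : R * R -> \bar R) : measurable_fun setT h ->
    measurable_fun setT
      (fun x => (moveP m delta x)%:E * h (x, (2 * m + delta - x)%R)).
  move=> mh; apply: emeasurable_funM => //.
  by apply: (measurableT_comp mh); exact: measurable_fun_pair.
split.
- move=> f g f0 fg; apply: (expect_le _ EI) => x.
    by rewrite adde_ge0// mule_ge0.
  by rewrite leeD// lee_wpmul2l.
- move=> f g mf f0 mg g0; rewrite -(expectD _ EI)//; first last.
  + by move=> x; rewrite adde_ge0// mule_ge0.
  + by apply: emeasurable_funD; [exact: m1|exact: m2].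
  + by move=> x; rewrite adde_ge0// mule_ge0.
  + by apply: emeasurable_funD; [exact: m1|exact: m2].
  by apply: eq_integral => x _; rewrite !ge0_muleDr// addeACA.
- move=> r f r0 mf f0; rewrite -(expectZ _ EI)//; last 2 first.
  + by apply: emeasurable_funD; [exact: m1|exact: m2].
  + by move=> x; rewrite adde_ge0// mule_ge0.
  apply: eq_integral => x _.
  by rewrite ge0_muleDr ?mule_ge0// !(muleCA r%:E).
- rewrite -[RHS](expect1 _ EI); apply: eq_integral => x _.
  by rewrite !mule1 -EFinD subrK.
- move=> d' S F mF F0.
  apply: (expect_measurable _ EI _ _ (fun z => (1 - moveP m delta z.2)%:E *
     F (z.1, (z.2, z.2)) + (moveP m delta z.2)%:E *
     F (z.1, (z.2, (2 * m + delta - z.2)%R)))); last first.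
    by move=> z; rewrite adde_ge0// mule_ge0.
  apply: emeasurable_funD; apply: emeasurable_funM.
  + exact: (measurableT_comp mQ).
  + apply: (measurableT_comp mF); apply: measurable_fun_pair => //.
    exact: measurable_fun_pair.
  + exact: (measurableT_comp mP).
  + apply: (measurableT_comp mF); apply: measurable_fun_pair => //.
    by apply: measurable_fun_pair => //; exact: (measurableT_comp mR).
Qed.

(** Both branches of the coupling keep [x] as first component, and their weights sum to 1. *)
Lemma reflE_fst p h : reflE p (fun v => h v.1) = \int[normal_prob p.1 1]_x h x.
Proof.
rewrite /reflE; apply: eq_integral => x _ /=.
rewrite -ge0_muleDl ?lee_fin ?subr_ge0 ?moveP_le1 ?moveP_ge0//.
by rewrite -EFinD subrK mul1e.
Qed.

(** The mass removed where the first density exceeds the second is reflected onto the points where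
    it falls short, by exactly the missing amount. *)
Lemma reflE_snd p h : measurable_fun [set: R] h -> (forall x, 0 <= h x) ->
  reflE p (fun v => h v.2) = \int[normal_prob (p.1 + p.2) 1]_x h x.
Proof.
case: p => m delta mh h0; rewrite /reflE/=.
have P0 x : 0 <= (moveP m delta x)%:E by rewrite lee_fin moveP_ge0.
have Q0 x : 0 <= (1 - moveP m delta x)%:E by rewrite lee_fin subr_ge0 moveP_le1.
have p0 x : 0 <= (normal_pdf m 1 x)%:E by rewrite lee_fin normal_pdf_ge0.
have mP : measurable_fun [set: R] (fun x => (moveP m delta x)%:E).
  by apply/measurable_EFinP; exact: measurable_moveP.
have mp : measurable_fun [set: R] (fun x => (normal_pdf m 1 x)%:E).
  by apply/measurable_EFinP; exact: measurable_normal_pdf.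
have mQ : measurable_fun [set: R] (fun x => (1 - moveP m delta x)%:E).
  by apply/measurable_EFinP/measurable_funB => //; exact: measurable_moveP.
have mR : measurable_fun [set: R] (fun x => 2 * m + delta - x)%R.
  exact: measurable_funB.
rewrite (integral_normal_prob (m + delta) h)//.
rewrite (integral_normal_prob m (fun x => (1 - moveP m delta x)%:E * h x +
  (moveP m delta x)%:E * h (2 * m + delta - x)%R)); last 2 first.
- apply: emeasurable_funD; apply: emeasurable_funM => //.
  exact: (measurableT_comp mh).
- by move=> x; rewrite adde_ge0// mule_ge0.
pose A x := (1 - moveP m delta x)%:E * h x * (normal_pdf m 1 x)%:E.
pose B x := (moveP m delta x)%:E * h (2 * m + delta - x)%R * (normal_pdf m 1 x)%:E.
have A0 x : 0 <= A x by rewrite !mule_ge0.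
have B0 x : 0 <= B x by rewrite !mule_ge0.
have mA : measurable_fun setT A by do 2 apply: emeasurable_funM => //.
have mB : measurable_fun setT B.
  do 2 apply: emeasurable_funM => //.
  exact: (measurableT_comp mh).
transitivity (\int[lebesgue_measure]_x (A x + B x)).
  by apply: eq_integral => x _; rewrite ge0_muleDl// mule_ge0.
(* Only the moved part [B] is reflected, so that both parts carry the factor [h x]. *)
rewrite ge0_integralD//= -[X in _ + X](integral_reflect (2 * m + delta))//.
rewrite -ge0_integralD//=; last exact: (measurableT_comp mB).
apply: eq_integral => x _; rewrite /A /B.
rewrite (_ : 2 * m + delta - (2 * m + delta - x) = x)%R; last by lra.
rewrite normal_pdf_reflect normal_pdf_shift -!muleA !(muleCA _ (h x)).
rewrite -!EFinM -ge0_muleDr; last 2 first.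
- by rewrite lee_fin mulr_ge0 ?normal_pdf_ge0// subr_ge0 moveP_le1.
- by rewrite lee_fin !mulr_ge0 ?moveP_ge0 ?lratio_ge0 ?normal_pdf_ge0.
congr (_ * _); rewrite -EFinD mulrA -mulrDl; congr (_ * _)%:E.
(* With [l] the likelihood ratio at [x], what remains is the identity
   [min(1, l) + l max(0, 1 - 1 / l) = l]. *)
rewrite /moveP lratio_reflect.
have : (0 < lratio m delta x)%R by exact: expR_gt0.
move: (lratio m delta x) => l l0.
rewrite maxr_pMl ?(ltW l0)// mul0r mulrBl mul1r mulVf ?gt_eqF//.
by rewrite /Num.max; case: ifPn; case: ifPn; lra.
Qed.

(** Chi-square bound: the ratio [l] has mean 1 and second moment [exp (delta^2)], so [(1 - l)^2] has
    mean at most [2 delta^2]. The pointwise inequality is arranged with nonnegative terms on both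
    sides, as additivity requires. *)
Lemma integral_moveP_le m delta : (0 < delta <= 1 / 2)%R ->
  \int[normal_prob m 1]_x (moveP m delta x)%:E <= (2 * delta)%:E.
Proof.
move=> /andP[delta0 delta1].
have EI := is_expectation_integral _ _ (normal_prob m 1).
have ml e : measurable_fun [set: R] (fun x => (lratio m e x)%:E).
  by apply/measurable_EFinP; exact: measurable_lratio.
have l0 e x : 0 <= (lratio m e x)%:E by rewrite lee_fin lratio_ge0.
have mP : measurable_fun [set: R] (fun x => (moveP m delta x)%:E).
  by apply/measurable_EFinP; exact: measurable_moveP.
have P0 x : 0 <= (moveP m delta x)%:E by rewrite lee_fin moveP_ge0.
have El e : \int[normal_prob m 1]_x (lratio m e x)%:E = 1.
  rewrite -[RHS](expect1 _ (is_expectation_integral _ _ (normal_prob (m + e) 1))).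
  rewrite (integral_normal_prob_shift m e (cst 1)); last 2 first.
  - exact: measurable_cst.
  - by move=> x; exact: lee01.
  by apply: eq_integral => x _; rewrite mule1.
have Z r f : (0 <= r)%R -> measurable_fun setT f -> (forall x, 0 <= f x) ->
    \int[normal_prob m 1]_x (r%:E * f x) = r%:E * \int[normal_prob m 1]_x f x.
  by move=> *; exact: (expectZ _ EI).
(* AM-GM [2 delta w <= delta^2 + w^2] with [w^2 <= (1 - l)^2]; the square of
   the likelihood ratio is [exp (delta^2)] times the ratio for the shift
   [2 delta]. *)
have key x : ((2 * delta) * moveP m delta x + 2 * lratio m delta x <=
    (1 + delta ^+ 2) + expR (delta ^+ 2) * lratio m (2 * delta) x)%R.
  have -> : (expR (delta ^+ 2) * lratio m (2 * delta) x = lratio m delta x ^+ 2)%R.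
    by rewrite /lratio -expRD -expRM_natl; congr expR; field.
  have := lratio_ge0 m delta x; rewrite /moveP; move: (lratio _ _ _) => l l0'.
  have := sqr_ge0 (1 - l - delta); have := sqr_ge0 (1 - l).
  have := sqr_ge0 delta.
  by rewrite /Num.max; case: ifPn => _; nra.
have D0 : (0 <= 1 + delta ^+ 2)%R by rewrite addr_ge0// sqr_ge0.
have : \int[normal_prob m 1]_x
      ((2 * delta)%:E * (moveP m delta x)%:E + 2%:E * (lratio m delta x)%:E) <=
    \int[normal_prob m 1]_x ((1 + delta ^+ 2)%:E +
      (expR (delta ^+ 2))%:E * (lratio m (2 * delta) x)%:E).
  apply: (expect_le _ EI) => x.
    by rewrite adde_ge0// mule_ge0// lee_fin//; lra.
  by rewrite -!EFinM -!EFinD lee_fin; exact: key.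
have dd0 : (0 <= 2 * delta)%R by lra.
have mM (r : R) f : measurable_fun [set: R] f ->
    measurable_fun [set: R] (fun x => r%:E * f x) by move=> mf; exact: emeasurable_funM.
have M0 (r : R) f : (0 <= r)%R -> (forall x, 0 <= f x) ->
    forall x : R, 0 <= r%:E * f x by move=> r0 f0 x; rewrite mule_ge0.
have D0' (x : R) : 0 <= (1 + delta ^+ 2)%:E by rewrite lee_fin.
rewrite (expectD _ EI _ _ (mM _ _ mP) (M0 _ _ dd0 P0) (mM _ _ (ml delta))
  (M0 _ _ (ler0n _ 2) (l0 delta))).
rewrite (expectD _ EI _ _ (measurable_cst _) D0' (mM _ _ (ml (2 * delta)%R))
  (M0 _ _ (expR_ge0 _) (l0 (2 * delta)%R))).
rewrite (expect_cst EI)// !Z ?expR_ge0// !El !mule1 => le1.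
have le2 : (expR (delta ^+ 2) <= 1 + 2 * delta ^+ 2)%R.
  by apply: expR_le1D2x; rewrite sqr_ge0/=; clear -delta0 delta1; nra.
have Pge0 : 0 <= \int[normal_prob m 1]_x (moveP m delta x)%:E.
  exact: (expect_ge0 EI).
move: le1 Pge0; case: (\int[normal_prob m 1]_x (moveP m delta x)%:E) => [r| |]//=.
- rewrite -EFinM -!EFinD !lee_fin => le1 r0.
  rewrite -(ler_pM2l delta0); move: le1 le2.
  by move: (expR _) => e; clear -delta0; nra.
- by rewrite mulry gtr0_sg ?mul1e// mulr_gt0.
Qed.

(** The weight is 2 to the indicator of a move, so its mean [c] is 1 plus the probability of a move.
    These are the one-point exponential moments for Chernoff's bound. *)
Lemma reflE_weight : exists c : R * R -> R, [/\ forall p, (1 <= c p)%R,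
  forall m, (c (m, 0) = 1)%R,
  forall m delta, (0 < delta <= 1 / 2)%R -> (c (m, delta) <= 1 + 2 * delta)%R
  & forall p, reflE p (fun v => (if v.1 == v.2 then 1 else 2)%R%:E) = (c p)%:E].
Proof.
pose g (v : R * R) : \bar R := (if v.1 == v.2 then 1 else 2)%R%:E.
have EI m := is_expectation_integral _ _ (normal_prob m 1).
have mP m delta : measurable_fun [set: R] (fun x => (moveP m delta x)%:E).
  by apply/measurable_EFinP; exact: measurable_moveP.
have P0 m delta x : 0 <= (moveP m delta x)%:E by rewrite lee_fin moveP_ge0.
have g1 v : 1 <= g v by rewrite /g; case: ifP => _; rewrite lee_fin; lra.
have ge1 p : 1 <= reflE p g.
  rewrite -[leLHS](expect1 _ (reflE_is_expectation p)).
  exact: (expect_le _ (reflE_is_expectation _)).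
have le_int m delta :
    reflE (m, delta) g <= 1 + \int[normal_prob m 1]_x (moveP m delta x)%:E.
  rewrite -(expect1 _ (EI m)).
  rewrite -(expectD _ (EI m) _ _ (measurable_cst _) (fun=> lee01) (mP m delta)
    (P0 m delta)).
  apply: (expect_le _ (EI m)) => x; rewrite /g/= eqxx -!EFinM -!EFinD lee_fin.
    rewrite addr_ge0// mulr_ge0// ?subr_ge0 ?moveP_le1 ?moveP_ge0//.
    by case: ifP => _; lra.
  have := moveP_ge0 m delta x.
  by case: ifP => _; lra.
have fin p : reflE p g \is a fin_num.
  rewrite ge0_fin_numE; last by apply: le_trans (ge1 p); rewrite lee_fin.
  apply: (@le_lt_trans _ _ 2%:E); last exact: ltry.
  have <- := expect_cst (reflE_is_expectation p) 2%R (ler0n _ 2).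
  apply: (expect_le _ (reflE_is_expectation p)) => v.
    exact: le_trans (g1 v).
  by rewrite /g; case: ifP => _; rewrite lee_fin; lra.
exists (fun p => fine (reflE p g)); split.
- by move=> p; rewrite -lee_fin fineK.
- move=> m; apply/EFin_inj; rewrite fineK//; apply/eqP; rewrite eq_le ge1 andbT.
  apply: le_trans (le_int m 0%R) _.
  by under eq_integral do rewrite moveP0; rewrite integral0 adde0.
- move=> m delta d12; rewrite -lee_fin fineK//; apply: le_trans (le_int _ _) _.
  by rewrite EFinD leeD2l// integral_moveP_le.
- by move=> p; rewrite fineK.
Qed.

End GaussianShift.

(** * Coupling of the data sets *)

Section DataCoupling.
Context {R : realType}.
Local Open Scope ereal_scope.

(* The library equips [R] with its Borel sets under two different displays;
   this transfers from the one of [normal_prob] to the canonical one. *)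
Lemma normal_prob_is_expectation (m : R) :
  is_expectation (T := R) (fun k : R -> \bar R => \int[normal_prob m 1%R]_x k x).
Proof.
have EI := is_expectation_integral _ _ (normal_prob m 1%R).
split.
- exact: expect_le EI.
- by move=> f g; exact: expectD EI f g.
- exact: expectZ EI.
- exact: expect1 EI.
- by move=> d S F mF F0; exact: (expect_measurable _ EI d S F mF F0).
Qed.

Lemma gaussE_tupE d (mu : d.-tuple R) h :
  gaussE mu h = tupE (fun m k => \int[normal_prob m 1]_x k x) mu h.
Proof. exact: (prodE_tupE (fun m k => \int[normal_prob m 1]_x k x) _ mu mu). Qed.

Lemma gaussE_is_expectation d (mu : d.-tuple R) :
  is_expectation (T := d.-tuple R) (gaussE mu).
Proof.
rewrite (_ : gaussE mu = tupE (fun m k => \int[normal_prob m 1]_x k x) mu).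
  by apply: tupE_is_expectation => m; exact: normal_prob_is_expectation.
by apply/funext => h; exact: gaussE_tupE.
Qed.

Lemma dataE_tupE d n (mu : d.-tuple R) (g : n.-tuple (d.-tuple R) -> \bar R) :
  dataE mu g = tupE (@gaussE R d) (nseq_tuple n mu) g.
Proof.
by rewrite -(prodE_tupE _ _ _ [tuple of nseq n mu]) map_nseq.
Qed.

Lemma dataE_is_expectation d n (mu : d.-tuple R) :
  is_expectation (T := n.-tuple (d.-tuple R)) (@dataE R d n mu).
Proof.
rewrite (_ : @dataE R d n mu = tupE (@gaussE R d) (nseq_tuple n mu)).
  by apply: tupE_is_expectation => m; exact: gaussE_is_expectation.
by apply/funext => h; exact: dataE_tupE.
Qed.

(** The law of [n] independent points whose coordinates are independent reflection couplings; each
    entry of [ps] is a pair (mean, shift). *)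
Definition dataC {d n : nat} (ps : d.-tuple (R * R))
    (H : n.-tuple (d.-tuple (R * R)) -> \bar R) : \bar R :=
  tupE (fun ps' => tupE reflE ps') (nseq_tuple n ps) H.

Definition fstD {d n : nat} (V : n.-tuple (d.-tuple (R * R))) :
  n.-tuple (d.-tuple R) := map_tuple (map_tuple fst) V.

Definition sndD {d n : nat} (V : n.-tuple (d.-tuple (R * R))) :
  n.-tuple (d.-tuple R) := map_tuple (map_tuple snd) V.

Lemma dataC_is_expectation d n (ps : d.-tuple (R * R)) :
  is_expectation (T := n.-tuple (d.-tuple (R * R))) (dataC ps).
Proof.
apply: tupE_is_expectation => ps'; apply: tupE_is_expectation => p.
exact: reflE_is_expectation.
Qed.

Lemma map_nseq_tuple {A B : Type} (a : A -> B) n x :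
  map_tuple a (nseq_tuple n x) = nseq_tuple n (a x).
Proof. by apply: val_inj; rewrite /= map_nseq. Qed.

Lemma dataC_fst d n (ps : d.-tuple (R * R)) (h : n.-tuple (d.-tuple R) -> \bar R) :
  dataC ps (fun V => h (fstD V)) = dataE (map_tuple fst ps) h.
Proof.
rewrite dataE_tupE -map_nseq_tuple; apply: tupE_map => ps' h'.
rewrite gaussE_tupE; apply: tupE_map => p h''; exact: reflE_fst.
Qed.

Lemma dataC_snd d n (ps : d.-tuple (R * R)) (h : n.-tuple (d.-tuple R) -> \bar R) :
  measurable_fun [set: n.-tuple (d.-tuple R)] h -> (forall X, 0 <= h X) ->
  dataC ps (fun V => h (sndD V)) = dataE (map_tuple (fun p => p.1 + p.2)%R ps) h.
Proof.
move=> mh h0; rewrite dataE_tupE -map_nseq_tuple.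
apply: (@tupE_map_measurable R _ _ _ _ (d.-tuple R) _ _ _ (@gaussE R d)) => //.
  by move=> mu; exact: gaussE_is_expectation.
move=> ps' h' mh' h'0; rewrite gaussE_tupE.
exact: (@tupE_map_measurable R (R * R) R (R * R) _ R (fun p => p.1 + p.2)%R snd
  reflE (fun m k => \int[normal_prob m 1]_x k x) normal_prob_is_expectation
  reflE_snd d ps' h' mh' h'0).
Qed.

Lemma measurable_map_tuple n d1 d2 (T1 : measurableType d1)
    (T2 : measurableType d2) (a : T1 -> T2) :
  measurable_fun [set: T1] a ->
  measurable_fun [set: n.-tuple T1] (map_tuple a : n.-tuple T1 -> n.-tuple T2).
Proof.
move=> ma; apply/measurable_fun_tnthP => i.
rewrite (_ : _ \o _ = fun t => a (tnth t i)); last first.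
  by apply/funext => t /=; rewrite tnth_map.
by apply: (measurableT_comp ma); exact: measurable_tnth.
Qed.

Lemma measurable_fstD d n :
  measurable_fun [set: n.-tuple (d.-tuple (R * R))] (@fstD d n).
Proof. by do 2 apply: measurable_map_tuple. Qed.

Lemma measurable_sndD d n :
  measurable_fun [set: n.-tuple (d.-tuple (R * R))] (@sndD d n).
Proof. by do 2 apply: measurable_map_tuple. Qed.

(** Equal to 2 to the number of moved scalar coordinates. The product form lets its expectation
    factorize. *)
Definition moveW {d n : nat} (V : n.-tuple (d.-tuple (R * R))) : R :=
  (\prod_(i < n) \prod_(j < d)
     (if (tnth (tnth V i) j).1 == (tnth (tnth V i) j).2 then 1 else 2))%R.

Lemma moveW_ge1 d n (V : n.-tuple (d.-tuple (R * R))) : (1 <= moveW V)%R.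
Proof.
rewrite /moveW; elim/big_ind: _ => //= [x y|i _]; first exact: mulr_ege1.
elim/big_ind: _ => //= [x y|j _]; first exact: mulr_ege1.
by case: ifP => _; lra.
Qed.

(** Every data point that differs has a differing coordinate, which contributes a factor 2. *)
Lemma dH_moveW d n (V : n.-tuple (d.-tuple (R * R))) :
  (2 ^+ dH (fstD V) (sndD V) <= moveW V)%R.
Proof.
rewrite /dH -prodr_const big_mkcond/=; apply: ler_prod => i _.
have prod_ge1 (P : pred 'I_d) : (1 <= \prod_(j < d | P j)
    (if (tnth (tnth V i) j).1 == (tnth (tnth V i) j).2 then 1 else 2 : R))%R.
  elim/big_ind: _ => //= [x y|j _]; first exact: mulr_ege1.
  by case: ifP => _; lra.
rewrite inE; case: ifPn => neq; last by rewrite ler01 prod_ge1.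
have /existsP[j jP] : [exists j, (tnth (tnth V i) j).1 != (tnth (tnth V i) j).2].
  apply: contraR neq => /existsPn eq; apply/eqP.
  rewrite !tnth_map; apply: eq_from_tnth => j; rewrite !tnth_map.
  by apply/eqP; rewrite -[_ == _]negbK; exact: eq.
rewrite (bigD1 j)//= (negbTE jP) ler0n/= -[leLHS]mulr1.
by rewrite ler_pM// ?ler01.
Qed.

Lemma measurable_move d1 (T : measurableType d1) (a b : T -> R) :
  measurable_fun [set: T] a -> measurable_fun [set: T] b ->
  measurable_fun [set: T] (fun x => if a x == b x then 1 else 2 : R)%R.
Proof.
by move=> ma mb; apply: measurable_fun_ifT => //; exact: measurable_fun_eqr.
Qed.

Lemma measurable_moveW d n :
  measurable_fun [set: n.-tuple (d.-tuple (R * R))] (@moveW d n).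
Proof.
apply: measurable_prod => i _; apply: measurable_prod => j _.
have mt : measurable_fun [set: n.-tuple (d.-tuple (R * R))]
    (fun V : n.-tuple (d.-tuple (R * R)) => tnth (tnth V i) j).
  apply: (@measurableT_comp _ _ _ _ _ _
    (fun t : d.-tuple (R * R) => tnth t j)); exact: measurable_tnth.
by apply: measurable_move; [exact: (measurableT_comp measurable_fst)|
  exact: (measurableT_comp measurable_snd)].
Qed.

Definition shift_at {d : nat} (mu : d.-tuple R) (j : 'I_d) (delta : R) :
    d.-tuple (R * R) :=
  [tuple (tnth mu i, if i == j then delta else 0)%R | i < d].

(** The expectation factorizes over points and coordinates. Coordinates with shift 0 give the factor
    1, so each point contributes only the factor of [j] and the bound is free of [d]. *)
Lemma dataC_moveW d n (mu : d.-tuple R) (j : 'I_d) (delta : R) :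
  (0 < delta <= 1 / 2)%R ->
  dataC (n := n) (shift_at mu j delta) (fun V => (moveW V)%:E) <=
  ((1 + 2 * delta) ^+ n)%:E.
Proof.
move=> d12; have [c [c1 c0 cdelta cE]] := @reflE_weight R.
have p0 (x : R) : (1 <= x -> 0 <= x)%R by exact: le_trans ler01.
have prod1 (ps : d.-tuple (R * R)) : tupE reflE ps (fun v =>
    (\prod_(j < d) (if (tnth v j).1 == (tnth v j).2 then 1 else 2))%R%:E) =
    (\prod_(j < d) c (tnth ps j))%R%:E.
  apply: (tupE_prod reflE (@reflE_is_expectation R)
    (fun v => if v.1 == v.2 then 1 else 2)%R c) => //.
  - by apply: measurable_move.
  - by move=> v; case: ifP => _; lra.
  - by move=> p; exact: p0.
rewrite /dataC /moveW (tupE_prod _ _ (fun v : d.-tuple (R * R) =>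
  (\prod_(j < d) (if (tnth v j).1 == (tnth v j).2 then 1 else 2))%R)
  (fun ps => (\prod_(j < d) c (tnth ps j))%R))//; last 4 first.
- by move=> ps; apply: tupE_is_expectation => p; exact: reflE_is_expectation.
- apply: measurable_prod => i _.
  by apply: measurable_move;
    [apply: (measurableT_comp measurable_fst)|
     apply: (measurableT_comp measurable_snd)];
    exact: measurable_tnth.
- by move=> v; apply: prodr_ge0 => i _; case: ifP => _; lra.
- by move=> ps; apply: prodr_ge0 => i _; exact: p0.
rewrite lee_fin -[X in (_ <= _ ^+ X)%R](card_ord n) -prodr_const.
apply: ler_prod => i _; rewrite prodr_ge0/=; last by move=> k _; exact: p0.
rewrite (tnth_nth (shift_at mu j delta)) nth_nseq ltn_ord (bigD1 j)//= big1.
  by rewrite mulr1 tnth_mktuple eqxx cdelta.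
by move=> k kj; rewrite tnth_mktuple (negbTE kj) c0.
Qed.

End DataCoupling.

(** * Increments of the mean along a coordinate *)

Lemma expect_addZ {R : realType} d (T : measurableType d)
    (E : (T -> \bar R) -> \bar R) (g h : T -> R) (r : R) :
  is_expectation E -> 0 <= r ->
  measurable_fun [set: T] g -> (forall x, 0 <= g x) ->
  measurable_fun [set: T] h -> (forall x, 0 <= h x) ->
  (E (fun x => (g x + r * h x)%:E) =
   E (fun x => (g x)%:E) + r%:E * E (fun x => (h x)%:E))%E.
Proof.
move=> EE r0 mg g0 mh h0.
have mgE : measurable_fun [set: T] (fun x => (g x)%:E) by exact/measurable_EFinP.
have mhE : measurable_fun [set: T] (fun x => (h x)%:E) by exact/measurable_EFinP.
have gE x : (0 <= (g x)%:E)%E by rewrite lee_fin.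
have hE x : (0 <= (h x)%:E)%E by rewrite lee_fin.
rewrite -(expectZ _ EE _ _ r0 mhE hE) -(expectD _ EE _ _ mgE gE)//.
- exact: emeasurable_funM.
- by move=> x; rewrite mule_ge0.
Qed.

Section Increment.
Context {R : realType} {d n : nat}.
Variable f : n.-tuple (d.-tuple R) -> d.-tuple R.
Hypothesis mf : measurable_fun [set: n.-tuple (d.-tuple R)] f.
Variable j : 'I_d.

Definition errE (mu : d.-tuple R) : \bar R :=
  dataE mu (fun X => ((tnth (f X) j - tnth mu j) ^+ 2)%:E).

(** The positive part replaces the coordinate itself so that the integrand is nonnegative; it is
    still 1-Lipschitz in the coordinate. *)
Definition posE (mu : d.-tuple R) : \bar R :=
  dataE mu (fun X => (Num.max 0 (tnth (f X) j))%:E).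

Definition addx (mu : d.-tuple R) (delta : R) : d.-tuple R :=
  [tuple (tnth mu i + if i == j then delta else 0)%R | i < d].

Lemma measurable_coord :
  measurable_fun [set: n.-tuple (d.-tuple R)] (fun X => tnth (f X) j).
Proof.
apply: (@measurableT_comp _ _ _ _ _ _ (fun t : d.-tuple R => tnth t j)) => //.
exact: measurable_tnth.
Qed.

Lemma le_l2dist (x y : d.-tuple R) : (tnth y j - tnth x j) ^+ 2 <= l2dist x y ^+ 2.
Proof.
rewrite /l2dist sqr_sqrtr; last by apply: sumr_ge0 => i _; exact: sqr_ge0.
rewrite (bigD1 j)//= -[leLHS]addr0 lerD//; last first.
  by apply: sumr_ge0 => i _; exact: sqr_ge0.
by rewrite -(opprB (tnth x j)) sqrrN.
Qed.

Lemma Sens_ge (eta : R) (k : nat) X X' : (k%:Z <= Num.floor (eta * n%:R))%R ->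
  (dH X X' <= k)%N ->
  (((tnth (f X') j - tnth (f X) j) ^+ 2)%:E <= Sens f eta X ^+ 2)%E.
Proof.
move=> ketan dk; have dist0 : 0 <= l2dist (f X) (f X') by exact: sqrtr_ge0.
have le_sup : ((l2dist (f X) (f X'))%:E <= Sens f eta X)%E.
  apply: ereal_sup_ubound; exists X' => //=.
  by apply: le_trans ketan; rewrite lez_nat.
apply: (@le_trans _ _ ((l2dist (f X) (f X')) ^+ 2)%:E).
  by rewrite lee_fin le_l2dist.
by rewrite !expe2 expr2 EFinM lee_pmul// ?lee_fin.
Qed.

(** The change [y] of the coordinate satisfies [|y| <= y^2 / (2 t) + t / 2], used on the good event,
    and [|y| <= a y^2 / 2 + 1 / (2 a)], used on the bad one. Both [t] and [a] are later taken
    proportional to [delta]. *)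
Lemma posE_increment (mu : d.-tuple R) (eta delta s2 t a : R) (k : nat) :
  0 < delta <= 1 / 2 -> 0 < t -> 0 < a ->
  (k%:Z <= Num.floor (eta * n%:R))%R ->
  (dataE mu (fun X => Sens f eta X ^+ 2) <= s2%:E)%E ->
  (posE (addx mu delta) <= posE mu + (s2 / (2 * t) +
     (t / 2 + 3 * a / 2 * delta ^+ 2) + (1 + 2 * delta) ^+ n / 2 ^+ k / (2 * a))%:E
     + (3 * a / 2)%:E * (errE mu + errE (addx mu delta)))%E.
Proof.
move=> d12 t0 a0 ketan s2P.
pose ps := shift_at mu j delta.
have fstE : map_tuple fst ps = mu.
  by apply: eq_from_tnth => i; rewrite tnth_map tnth_mktuple.
have sndE : map_tuple (fun p : R * R => p.1 + p.2) ps = addx mu delta.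
  by apply: eq_from_tnth => i; rewrite tnth_map !tnth_mktuple.
have dE h : dataE mu h = dataC ps (fun V => h (@fstD R d n V)).
  by rewrite dataC_fst fstE.
have EC := dataC_is_expectation d n ps.
have mc := measurable_coord.
have m1 : measurable_fun setT (fun V => tnth (f (@fstD R d n V)) j).
  by apply: (measurableT_comp mc); exact: measurable_fstD.
have m2 : measurable_fun setT (fun V => tnth (f (@sndD R d n V)) j).
  by apply: (measurableT_comp mc); exact: measurable_sndD.
have mW := @measurable_moveW R d n.
pose A V := Num.max 0 (tnth (f (@fstD R d n V)) j).
pose A' V := Num.max 0 (tnth (f (@sndD R d n V)) j).
pose y V := tnth (f (@sndD R d n V)) j - tnth (f (@fstD R d n V)) j.
(* [D] is a measurable stand-in for the squared sensitivity on the good event, so that linearity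
   applies; monotonicity alone then compares it with the sensitivity. *)
pose D V := if moveW V <= 2 ^+ k then y V ^+ 2 else 0.
pose e V := (tnth (f (@fstD R d n V)) j - tnth mu j) ^+ 2.
pose e' V := (tnth (f (@sndD R d n V)) j - tnth (addx mu delta) j) ^+ 2.
have mA : measurable_fun setT A by exact: measurable_maxr.
have mD : measurable_fun setT D.
  apply: measurable_fun_ifT => //; first exact: measurable_fun_ler.
  by apply: measurable_funX; exact: measurable_funB.
have me : measurable_fun setT e by apply: measurable_funX; exact: measurable_funB.
have me' : measurable_fun setT e' by apply: measurable_funX; exact: measurable_funB.
have A0 V : 0 <= A V by rewrite /A le_max lexx.
have A'0 V : 0 <= A' V by rewrite /A' le_max lexx.
have D0 V : 0 <= D V by rewrite /D; case: ifP => // _; exact: sqr_ge0.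
have e0 V : 0 <= e V by exact: sqr_ge0.
have e'0 V : 0 <= e' V by exact: sqr_ge0.
have W0 (V : n.-tuple (d.-tuple (R * R))) : 0 <= moveW V.
  by apply: (@le_trans _ _ 1) => //; exact: moveW_ge1.
have k0 : 0 < 2 ^+ k :> R by exact: exprn_gt0.
have k1 : 0 <= (2 ^+ k)^-1 / (2 * a) by rewrite mulr_ge0 ?invr_ge0 ?ltW// mulr_gt0.
have t1 : 0 <= (2 * t)^-1 by rewrite invr_ge0 ltW// mulr_gt0.
have a1 : 0 <= 3 * a / 2 by lra.
have c1 : 0 <= t / 2 + 3 * a / 2 * delta ^+ 2.
  by rewrite addr_ge0 ?mulr_ge0 ?sqr_ge0//; lra.
(* Off the bad event [moveW V > 2 ^ k] the change of [f] is controlled by the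
   sensitivity; on it, by the errors and Markov's bound [1 <= moveW V / 2 ^ k]. *)
have pointwise V : A' V <= A V + (2 * t)^-1 * D V +
    (t / 2 + 3 * a / 2 * delta ^+ 2) * 1 + (2 ^+ k)^-1 / (2 * a) * moveW V +
    3 * a / 2 * e V + 3 * a / 2 * e' V.
  have Ay : A' V <= A V + `|y V|.
    rewrite /A' /A /y; move: (tnth (f (sndD _)) _) (tnth (f (fstD _)) _) => u v.
    have := ler_norm (u - v); have := normr_ge0 (u - v).
    by rewrite /Num.max; case: ifPn => _; case: ifPn; lra.
  (* Here [y] is the error at the shifted mean, plus [delta], minus the error at [mu]: three terms,
     hence the factor 3. *)
  have y2 : y V ^+ 2 <= 3 * (e V + e' V + delta ^+ 2).
    rewrite /y /e /e' tnth_mktuple eqxx.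
    move: (tnth (f (sndD _)) _) (tnth (f (fstD _)) _) (tnth mu j) => u v w.
    have := sqr_ge0 ((u - (w + delta)) - delta).
    have := sqr_ge0 (delta + (v - w)).
    by have := sqr_ge0 ((u - (w + delta)) + (v - w)); nra.
  have amgm c : 0 < c -> `|y V| <= c / 2 * y V ^+ 2 + (2 * c)^-1.
    move=> c0; rewrite -real_normK ?num_real//; move: (`|y V|) => z.
    rewrite -subr_ge0 (_ : _ - z = (c * z - 1) ^+ 2 / (2 * c)).
      by rewrite divr_ge0 ?sqr_ge0// mulr_ge0// ltW.
    by field; rewrite gt_eqF.
  rewrite mulr1; apply: le_trans Ay _; rewrite -!addrA lerD2l.
  move: (W0 V) (e0 V) (e'0 V) y2; rewrite /D.
  case: ifPn => [_|]; last rewrite -ltNge => W2.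
    have := amgm t^-1; rewrite invr_gt0 => /(_ t0).
    rewrite invfM invrK (mulrC 2^-1 t).
    have -> : t^-1 / 2 = (2 * t)^-1 by rewrite invfM mulrC.
    move: (W0 V) => W0V H1 H2 H3 H4 _.
    have := mulr_ge0 k1 W0V; have := mulr_ge0 a1 H3; have := mulr_ge0 a1 H4.
    by have := mulr_ge0 a1 (sqr_ge0 delta); lra.
  (* On the bad event [y2] turns [a / 2] into [3 a / 2], and the constant [1 / (2 a)] is paid for by
     [moveW V / 2 ^ k > 1]. *)
  have := amgm a a0 => H1 H2 H3 H4 H5.
  have {}H5 := ler_wpM2l (ltW a0) H5.
  have : (2 * a)^-1 <= (2 ^+ k)^-1 / (2 * a) * moveW V.
    rewrite mulrAC -[leLHS]mul1r ler_pM2r ?invr_gt0 ?mulr_gt0//.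
    by rewrite ler_pdivlMl// mulr1 ltW.
  by rewrite mulr0; lra.
have -> : posE (addx mu delta) = dataC ps (fun V => (A' V)%:E).
  rewrite /posE -sndE -dataC_snd//.
  - by apply/measurable_EFinP; exact: measurable_maxr.
  - by move=> X; rewrite lee_fin le_max lexx.
apply: (@le_trans _ _ (dataC ps (fun V => (A V + (2 * t)^-1 * D V +
    (t / 2 + 3 * a / 2 * delta ^+ 2) * 1 + (2 ^+ k)^-1 / (2 * a) * moveW V +
    3 * a / 2 * e V + 3 * a / 2 * e' V)%:E))).
  by apply: (expect_le _ EC) => V; rewrite lee_fin; [exact: A'0|exact: pointwise].
pose nn (g : n.-tuple (d.-tuple (R * R)) -> R) :=
  measurable_fun setT g /\ forall V, 0 <= g V.
have addZ g h r : nn g -> nn h -> 0 <= r -> nn (fun V => g V + r * h V) /\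
    dataC ps (fun V => (g V + r * h V)%:E) =
    (dataC ps (fun V => (g V)%:E) + r%:E * dataC ps (fun V => (h V)%:E))%E.
  move=> [mg g0] [mh h0] r0; split; last exact: (expect_addZ _ _ _ _ _ _ EC).
  split; first by apply: measurable_funD => //; exact: measurable_funM.
  by move=> V; rewrite addr_ge0// mulr_ge0.
have [g1 E1] := addZ _ _ _ (conj mA A0) (conj mD D0) t1.
have [g2 E2] := addZ _ _ _ g1 (conj (measurable_cst _) (fun=> ler01)) c1.
have [g3 E3] := addZ _ _ _ g2 (conj mW W0) k1.
have [g4 E4] := addZ _ _ _ g3 (conj me e0) a1.
have [_ E5] := addZ _ _ _ g4 (conj me' e'0) a1.
rewrite E5 E4 E3 E2 E1.
rewrite (expect1 _ EC) mule1.
have -> : dataC ps (fun V => (A V)%:E) = posE mu by rewrite /posE dE.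
have -> : dataC ps (fun V => (e V)%:E) = errE mu by rewrite /errE dE.
have -> : dataC ps (fun V => (e' V)%:E) = errE (addx mu delta).
  rewrite /errE -sndE -dataC_snd ?sndE//.
  - by apply/measurable_EFinP; apply: measurable_funX; exact: measurable_funB.
  - by move=> X; rewrite lee_fin sqr_ge0.
have Ds : (dataC ps (fun V => (D V)%:E) <= s2%:E)%E.
  apply: le_trans s2P; rewrite dE.
  apply: (expect_le _ EC) => V; rewrite ?lee_fin// /D.
  case: ifPn => [W2|_]; last exact: sqre_ge0.
  apply: (Sens_ge _ _ _ _ ketan).
  by rewrite -(@ler_eXn2l R 2) ?ltr1n//; exact: le_trans (dH_moveW d n V) W2.
have We := dataC_moveW d n mu j delta d12.
have err0 nu : (0 <= errE nu)%E.
  apply: (expect_ge0 (dataE_is_expectation d n nu)) => X.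
  by rewrite lee_fin sqr_ge0.
rewrite ge0_muleDr// (EFinD (s2 / (2 * t) + _)) (EFinD (s2 / (2 * t))) !addeA.
do 2 apply: leeD => //; apply: leeD.
  apply: leeD => //; apply: leeD => //.
  by rewrite [s2 / _]mulrC EFinM lee_wpmul2l// lee_fin.
rewrite [leRHS](_ : _ = ((2 ^+ k)^-1 / (2 * a) * (1 + 2 * delta) ^+ n)%:E).
  by rewrite [leRHS]EFinM lee_wpmul2l// lee_fin.
by rewrite -mulrA mulrC.
Qed.

End Increment.

(** * Averaging over a grid *)

Section GridAverage.
Context {R : realType} {d : nat}.
Variables (F G : 'I_d -> d.-tuple R -> R) (delta kappa b B e : R).
Hypothesis b0 : 0 <= b.
Hypothesis delta0 : 0 <= delta.
Hypothesis F0 : forall j mu, 0 <= F j mu.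
Hypothesis FB : forall mu, \sum_(j < d) F j mu <= B.
Hypothesis Ge : forall j mu, 0 <= tnth mu j -> `|G j mu - tnth mu j| <= e.
Hypothesis GF : forall j mu, 0 <= tnth mu j ->
  G j (addx j mu delta) <= G j mu + kappa + b * (F j mu + F j (addx j mu delta)).

(** Summing [GF] along the line counts each interior error twice, while [Ge] at the two ends shows
    that [G] grows by [M delta] up to [2 e]. *)
Lemma telescope_line j (L : nat -> d.-tuple R) :
  (forall c, L c.+1 = addx j (L c) delta) -> tnth (L 0) j = 0 ->
  forall M, M%:R * delta - 2 * e - M%:R * kappa <=
    2 * b * \sum_(c < M.+1) F j (L c).
Proof.
move=> LS L0 M.
have Lj c : tnth (L c) j = c%:R * delta.
  elim: c => [|c IH]; first by rewrite L0 mul0r.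
  by rewrite LS tnth_mktuple eqxx IH -natr1 mulrDl mul1r.
(* The end points are counted once only; keeping [b * F j (L M)] on the left makes the induction
   close. *)
have tele : G j (L M) + b * F j (L M) <= G j (L 0) + M%:R * kappa +
    2 * b * \sum_(c < M.+1) F j (L c) - b * F j (L 0).
  elim: M => [|M IH]; first by rewrite big_ord1; lra.
  rewrite big_ord_recr/=; have := GF j (L M).
  rewrite Lj mulr_ge0 ?ler0n// -LS => /(_ isT).
  by have := mulr_ge0 b0 (F0 j (L M)); rewrite -natr1; lra.
have := Ge j (L M); rewrite Lj mulr_ge0// ?ler0n// => /(_ isT).
have := Ge j (L 0); rewrite Lj mul0r lexx => /(_ isT).
rewrite !ler_norml => /andP[_ H1] /andP[H2 _].
have := mulr_ge0 b0 (F0 j (L M)); have := mulr_ge0 b0 (F0 j (L 0)).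
lra.
Qed.

(** Each grid point lies on one line in direction [i], and that line is listed once for each of its
    [#|J|] points. *)
Lemma sum_ffun_update (I J : finType) (i : I) (H : {ffun I -> J} -> R) :
  \sum_(a : {ffun I -> J}) \sum_(c : J) H [ffun k => if k == i then c else a k] =
  #|J|%:R * \sum_(a : {ffun I -> J}) H a.
Proof.
rewrite mulr_natl -sumrMnl pair_big/=.
(* Exchanging [c] with the old value at [i] is an involution. *)
pose s (p : {ffun I -> J} * J) : {ffun I -> J} * J :=
  ([ffun k => if k == i then p.2 else p.1 k], p.1 i).
have sK : involutive s.
  move=> [a c]; rewrite /s/= ffunE eqxx; congr (_, _).
  by apply/ffunP => k; rewrite !ffunE; case: eqVneq => [->|].
rewrite (reindex_inj (inv_inj sK))/=.
transitivity (\sum_(a : {ffun I -> J}) \sum_(c : J) H a).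
  rewrite pair_big/=; apply: eq_bigr => -[a c] _ /=; congr H.
  apply/ffunP => k; rewrite !ffunE/=.
  by case: eqVneq => [->|//].
by apply: eq_bigr => a _; rewrite sumr_const.
Qed.

Lemma grid_bound (M : nat) :
  d%:R * (M%:R * delta - 2 * e - M%:R * kappa) <= 2 * b * (M.+1%:R * B).
Proof.
pose pt (a : {ffun 'I_d -> 'I_M.+1}) : d.-tuple R := [tuple (a i)%:R * delta | i < d].
pose N : R := #|{ffun 'I_d -> 'I_M.+1}|%:R.
have N0 : 0 < N.
  by rewrite ltr0n; apply/card_gt0P; exists [ffun=> ord0].
have line j (a : {ffun 'I_d -> 'I_M.+1}) : M%:R * delta - 2 * e - M%:R * kappa <=
    2 * b * \sum_(c < M.+1) F j (pt [ffun k => if k == j then c else a k]).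
  pose L c : d.-tuple R :=
    [tuple (if i == j then c else a i : nat)%:R * delta | i < d].
  have -> : \sum_(c < M.+1) F j (pt [ffun k => if k == j then c else a k]) =
      \sum_(c < M.+1) F j (L c).
    apply: eq_bigr => c _; congr F; apply: eq_from_tnth => i.
    by rewrite !tnth_mktuple ffunE; case: ifP.
  apply: (telescope_line j L).
    move=> c; apply: eq_from_tnth => i; rewrite !tnth_mktuple.
    by case: ifP => _; rewrite ?addr0// -natr1 mulrDl mul1r.
  by rewrite tnth_mktuple eqxx mul0r.
have sum_cst (I : finType) (x : R) : \sum_(i : I) x = #|I|%:R * x.
  by rewrite sumr_const mulr_natl.
rewrite -(ler_pM2l N0).
apply: (@le_trans _ _ (\sum_(j < d) \sum_(a : {ffun 'I_d -> 'I_M.+1})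
    2 * b * \sum_(c < M.+1) F j (pt [ffun k => if k == j then c else a k]))).
  rewrite mulrCA -{1}(card_ord d) -sum_cst; apply: ler_sum => j _.
  rewrite -sum_cst.
  by apply: ler_sum => a _; exact: line.
under eq_bigr => j _.
  rewrite -mulr_sumr (sum_ffun_update _ _ j (fun a => F j (pt a))) card_ord.
  over.
(* The sum over directions is moved inside, so that [FB] bounds the total error at each grid point
   by [B], with no factor [d]. *)
rewrite -!mulr_sumr exchange_big/= [leRHS]mulrCA ler_wpM2l ?mulr_ge0//.
rewrite [leRHS]mulrCA ler_wpM2l// -sum_cst.
by apply: ler_sum => a _; exact: FB.
Qed.

(** For long lines the end error [e] is negligible against [M] steps. *)
Lemma grid_limit : d%:R * (delta - kappa) <= 4 * b * B.
Proof.
have B0 : 0 <= B.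
  apply: le_trans (FB [tuple 0 | _ < d]); apply: sumr_ge0 => j _; exact: F0.
rewrite leNgt; apply/negP => lt.
pose x := d%:R * (delta - kappa) - 4 * b * B.
have x0 : 0 < x by rewrite subr_gt0.
(* This [M] beats the end error and, being a successor, satisfies [M + 1 <= 2 M], which turns the
   constant 2 into 4. *)
pose M := (Num.truncn (2 * d%:R * `|e| / x)).+1.
have Mx : 2 * d%:R * `|e| < M%:R * x.
  by rewrite -ltr_pdivrMr//; exact: truncnS_gt.
have := grid_bound M; rewrite leNgt => /negP; apply.
have M1 : M.+1%:R <= 2 * M%:R :> R.
  by rewrite -natrM ler_nat mul2n -addnn -addn1 leq_add2l.
have bB : 0 <= b * B by exact: mulr_ge0.
have := ler_wpM2l bB M1.
have d0 : 0 <= d%:R :> R by exact: ler0n.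
have := ler_wpM2l d0 (ler_norm e).
move: Mx; rewrite /x; nra.
Qed.

End GridAverage.

(** * The lower bound *)

Lemma expect_sum {R : realType} d (T : measurableType d)
    (E : (T -> \bar R) -> \bar R) (I : Type) (r : seq I) (h : I -> T -> R) :
  is_expectation E -> (forall i, measurable_fun [set: T] (h i)) ->
  (forall i x, 0 <= h i x) ->
  (E (fun x => (\sum_(i <- r) h i x)%:E) = \sum_(i <- r) E (fun x => (h i x)%:E))%E.
Proof.
move=> EE mh h0; elim: r => [|i r IH].
  rewrite big_nil (_ : (fun x => _) = fun=> 0%E); last first.
    by apply/funext => x; rewrite big_nil.
  exact: (expect_cst EE 0).
rewrite big_cons -IH -[X in (_ + X)%E]mul1e -(expect_addZ _ _ _ _ _ _ EE)//.
- by congr E; apply/funext => x; rewrite big_cons mul1r.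
- by apply: measurable_sum.
- by move=> x; apply: sumr_ge0.
Qed.

Section Accuracy.
Context {R : realType} {d n : nat}.
Variable f : n.-tuple (d.-tuple R) -> d.-tuple R.
Hypothesis mf : measurable_fun [set: n.-tuple (d.-tuple R)] f.
Implicit Types (mu : d.-tuple R) (j : 'I_d).

Lemma measurable_err mu j : measurable_fun [set: n.-tuple (d.-tuple R)]
  (fun X => (tnth (f X) j - tnth mu j) ^+ 2).
Proof.
by apply: measurable_funX; apply: measurable_funB => //; exact: measurable_coord.
Qed.

Lemma sum_errE mu : (\sum_(j < d) errE f j mu =
  dataE mu (fun X => ((l2dist (f X) mu) ^+ 2)%:E))%E.
Proof.
have EE := dataE_is_expectation d n mu.
rewrite -(expect_sum _ _ _ _ _ _ EE (measurable_err mu)).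
  congr (dataE _ _); apply/funext => X; rewrite /l2dist sqr_sqrtr//.
  by apply: sumr_ge0 => i _; exact: sqr_ge0.
by move=> j X; exact: sqr_ge0.
Qed.

Lemma errE_ge0 mu j : (0 <= errE f j mu)%E.
Proof.
by apply: (expect_ge0 (dataE_is_expectation d n mu)) => X; rewrite lee_fin sqr_ge0.
Qed.

(** As [tnth mu j] is its own positive part, the deviation is at most [|z|] for [z] the error, and
    [|z| <= (1 + z^2) / 2]. *)
Lemma posE_bounds mu j : 0 <= tnth mu j ->
  (posE f j mu <= (tnth mu j + 1 / 2)%:E + (1 / 2)%:E * errE f j mu)%E /\
  ((tnth mu j)%:E <= posE f j mu + (1 / 2)%:E + (1 / 2)%:E * errE f j mu)%E.
Proof.
move=> mu0; have EE := dataE_is_expectation d n mu.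
have mc := measurable_coord f mf j.
have h0 : 0 <= 1 / 2 :> R by lra.
have p0 X : 0 <= Num.max 0 (tnth (f X) j) by rewrite le_max lexx.
have mp : measurable_fun [set: n.-tuple (d.-tuple R)]
  (fun X => Num.max 0 (tnth (f X) j)) by exact: measurable_maxr.
have e0 X : 0 <= (tnth (f X) j - tnth mu j) ^+ 2 by exact: sqr_ge0.
have me := measurable_err mu j.
split.
  rewrite -(expect_cst EE); last by lra.
  rewrite -(expect_addZ _ _ _ (fun=> tnth mu j + 1 / 2) _ _ EE)//; last first.
    by move=> _; lra.
  apply: (expect_le _ EE) => X; rewrite lee_fin//.
  have := sqr_ge0 (tnth (f X) j - tnth mu j - 1).
  have := sqr_ge0 (tnth (f X) j - tnth mu j).
  by rewrite /Num.max; case: ifPn; nra.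
rewrite -[leLHS](expect_cst EE)// -[X in (_ + X + _)%E]mule1 -(expect1 _ EE).
rewrite -(expect_addZ _ _ _ _ (fun=> 1) _ EE)// -(expect_addZ _ _ _ _ _ _ EE)//.
- apply: (expect_le _ EE) => X; rewrite lee_fin//.
  have := sqr_ge0 (tnth (f X) j - tnth mu j + 1).
  have := sqr_ge0 (tnth (f X) j - tnth mu j).
  by rewrite /Num.max; case: ifPn; nra.
- by apply: measurable_funD => //; exact: measurable_funM.
- by move=> X; rewrite addr_ge0// mulr1.
Qed.

(** This is [grid_limit] with [F] the coordinate error, [G] the mean positive part and
    [b = 3 a / 2], so that [4 b B / d = 6 a B / d]. *)
Lemma sensitivity_lower_bound (eta B delta s2 t a : R) (k : nat) :
  (0 < d)%N -> 0 <= B ->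
  (forall mu, dataE mu (fun X => ((l2dist (f X) mu) ^+ 2)%:E) <= B%:E)%E ->
  0 < delta <= 1 / 2 -> 0 < t -> 0 < a -> (k%:Z <= Num.floor (eta * n%:R))%R ->
  (forall mu, dataE mu (fun X => Sens f eta X ^+ 2) <= s2%:E)%E ->
  delta <= s2 / (2 * t) + (t / 2 + 3 * a / 2 * delta ^+ 2) +
    (1 + 2 * delta) ^+ n / 2 ^+ k / (2 * a) + 6 * a * (B / d%:R).
Proof.
move=> d0 B0 fB d12 t0 a0 ketan sB; have /andP[delta0 _] := d12.
have errB mu j : (errE f j mu <= B%:E)%E.
  apply: le_trans (fB mu); rewrite -sum_errE (bigD1 j)//= leeDl//.
  by apply: sume_ge0 => i _; exact: errE_ge0.
pose F j mu := fine (errE f j mu).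
have FE mu j : errE f j mu = (F j mu)%:E.
  by rewrite fineK// ge0_fin_numE ?errE_ge0//; apply: le_lt_trans (errB _ _) (ltry _).
have F0 j mu : 0 <= F j mu by rewrite -lee_fin -FE errE_ge0.
have FB mu : \sum_(j < d) F j mu <= B.
  rewrite -lee_fin; apply: le_trans (fB mu); rewrite -sum_errE -sumEFin.
  by apply: lee_sum => j _; rewrite FE.
have FB1 j mu : F j mu <= B by rewrite -lee_fin -FE.
pose G j mu := fine (posE f j mu).
have posE_ge0 mu j : (0 <= posE f j mu)%E.
  apply: (expect_ge0 (dataE_is_expectation d n mu)) => X.
  by rewrite lee_fin le_max lexx.
pose kappa := s2 / (2 * t) + (t / 2 + 3 * a / 2 * delta ^+ 2) +
  (1 + 2 * delta) ^+ n / 2 ^+ k / (2 * a).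
have inc j mu : (posE f j (addx j mu delta) <= posE f j mu + (kappa +
    3 * a / 2 * (F j mu + F j (addx j mu delta)))%:E)%E.
  have := posE_increment f mf j mu eta delta s2 t a k d12 t0 a0 ketan (sB mu).
  by rewrite !FE -EFinD -EFinM -addeA -EFinD.
have posfin j mu : 0 <= tnth mu j -> posE f j mu \is a fin_num.
  move=> mu0; rewrite ge0_fin_numE ?posE_ge0//.
  have [le1 _] := posE_bounds mu j mu0.
  by apply: le_lt_trans le1 _; rewrite FE -EFinM -EFinD ltry.
have shift0 j mu : 0 <= tnth mu j -> 0 <= tnth (addx j mu delta) j.
  by move=> mu0; rewrite tnth_mktuple eqxx; lra.
have b0 : 0 <= 3 * a / 2 by lra.
have Ge j mu : 0 <= tnth mu j -> `|G j mu - tnth mu j| <= (1 + B) / 2.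
  move=> mu0; have [] := posE_bounds mu j mu0.
  rewrite -(fineK (posfin _ _ mu0)) FE -/(G j mu) -!EFinM -!EFinD !lee_fin.
  by have := FB1 j mu; rewrite ler_norml => H1 H2 H3; apply/andP; split; lra.
have GF j mu : 0 <= tnth mu j -> G j (addx j mu delta) <=
    G j mu + kappa + 3 * a / 2 * (F j mu + F j (addx j mu delta)).
  move=> mu0; have := inc j mu.
  rewrite -(fineK (posfin _ _ mu0)) -(fineK (posfin _ _ (shift0 _ _ mu0))).
  by rewrite -EFinD lee_fin addrA.
have := grid_limit F G delta kappa (3 * a / 2) B _ b0 (ltW delta0) F0 FB Ge GF.
have dR : 0 < d%:R :> R by rewrite ltr0n.
rewrite -ler_pdivlMl// mulrC -mulrA -/kappa => le1.
rewrite -lerBlDl; apply: le_trans le1 _.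
by rewrite le_eqVlt; apply/orP; left; apply/eqP; field; rewrite gt_eqF.
Qed.

End Accuracy.

(** Since [2 delta n = k / 4] and [exp (1 / 2) <= 2], the left side is at most
    [exp (- k / 4) <= n^-3]. As [delta >= 1 / (8 n)], this is below the right side once
    [n >= 8 * 64 * K]. *)
Lemma tail_bound {R : realType} (K delta : R) (n k : nat) : 1 <= K ->
  1 < n%:R :> R -> 512 * K <= n%:R -> 12 * ln n%:R <= k%:R :> R ->
  delta = k%:R / (8 * n%:R) ->
  (1 + 2 * delta) ^+ n / 2 ^+ k <= delta ^+ 2 / (8 * K).
Proof.
move=> K1 n1 nK kn deltaE; have n0 : 0 < n%:R :> R by lra.
have k1 : 1 <= k%:R :> R.
  rewrite ler1n; have := ln_gt0 n1; case: k kn deltaE => [|//] kn _ ln0.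
  by exfalso; lra.
have delta0 : 0 < delta by rewrite deltaE divr_gt0 ?mulr_gt0//; lra.
have le1 : (1 + 2 * delta) ^+ n <= expR (k%:R / 4).
  have -> : k%:R / 4 = 2 * delta * n%:R.
    by rewrite deltaE; field; rewrite gt_eqF.
  rewrite expRM_natr lerXn2r ?nnegrE ?expR_ge0 ?expR_ge1Dx//; lra.
have le2 : expR (k%:R / 2) <= 2 ^+ k :> R.
  have -> : k%:R / 2 = (1 / 2) * k%:R :> R by rewrite mulrC div1r.
  rewrite expRM_natr lerXn2r ?nnegrE ?expR_ge0//.
  by have := expR_le1D2x (1 / 2 : R); rewrite lexx divr_ge0// => /(_ isT); lra.
have le3 : (1 + 2 * delta) ^+ n / 2 ^+ k <= n%:R ^- 3.
  apply: (@le_trans _ _ (expR (k%:R / 4) / expR (k%:R / 2))).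
    rewrite ler_pM ?exprn_ge0 ?invr_ge0 ?addr_ge0 ?mulr_ge0 ?(ltW delta0)//.
    by rewrite lef_pV2 ?posrE ?exprn_gt0 ?expR_gt0.
  rewrite -expRN -expRD.
  rewrite -[X in _ <= X ^- 3](lnK (_ : n%:R \is Num.pos)) ?posrE//.
  by rewrite -expRM_natr -expRN ler_expR; lra.
apply: le_trans le3 _; rewrite ler_pdivlMr; last lra.
rewrite deltaE expr_div_n ler_pdivlMr ?exprn_gt0 ?mulr_gt0//.
apply: (@le_trans _ _ 1); last by rewrite expr_ge1//; lra.
rewrite [leLHS](_ : _ = 512 * K / n%:R); last by field; rewrite gt_eqF.
by rewrite ler_pdivrMr// mul1r.
Qed.

Lemma sqrte_lt {R : realType} (x : \bar R) (r : R) : 0 <= r ->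
  (Defs.sqrte x < r%:E)%E -> (x <= (r ^+ 2)%:E)%E.
Proof.
move=> r0; case: x => [x| |]//=; last by rewrite leNye.
rewrite lte_fin lee_fin; have [x0|x0] := leP 0 x => [lt|_].
  by rewrite -(sqr_sqrtr x0) lerXn2r ?nnegrE ?sqrtr_ge0// ltW.
by rewrite (le_trans (ltW x0))// sqr_ge0.
Qed.

Theorem theorem3p4 (R : realType) (C_MSE : R) : 0 < C_MSE ->
  exists (C_high c_high : R) (N0 : nat),
    0 < C_high /\ 0 < c_high /\
    forall (d n : nat), (1 <= d)%N -> (N0 <= n)%N ->
    forall f : n.-tuple (d.-tuple R) -> d.-tuple R,
      measurable_fun [set: n.-tuple (d.-tuple R)] f ->
      unif_MSE_accurate f C_MSE ->
    forall eta : R, 0 < eta -> eta < 1 / 10 ->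
      C_high * ln n%:R <= (Num.floor (eta * n%:R))%:~R ->
      ((c_high * eta)%:E <= ereal_sup [set ES2 f eta mu | mu in [set: d.-tuple R]])%E.
Proof.
(* [K] is such that [3 a / 2 + 6 a C_MSE <= a K], the total weight of the error terms at the end. *)
move=> C0; pose K := 2 + 6 * C_MSE.
(* 12 makes the tail at most [n^-3]; [1 / 64] comes from [eta <= 16 delta] and the target
   sensitivity [delta / 4]; the threshold on [n] ensures [512 K <= n]. *)
exists 12, (1 / 64), (Num.truncn (512 * K)).+1; split=> //; split; first by lra.
move=> d n d1 Nn f mf fMSE eta eta0 eta1 etan.
have nK : 512 * K <= n%:R.
  by apply: ltW; apply: lt_le_trans (truncnS_gt _) _; rewrite ler_nat.
have K1 : 2 <= K by rewrite /K; lra.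
have n1 : 1 < n%:R :> R by lra.
have n0 : 0 < n%:R :> R by lra.
have ln0 := ln_gt0 n1.
have [k kE] : exists k : nat, Num.floor (eta * n%:R) = k%:Z.
  exists `|Num.floor (eta * n%:R)|%N; rewrite gez0_abs//.
  by rewrite -(ler0z R); lra.
move: etan; rewrite kE => etan.
have kpos : (0 < k)%N by rewrite -(ltr0n R); apply: lt_le_trans etan; lra.
have k1 : 1 <= k%:R :> R by rewrite ler1n.
have [fl1 fl2] : k%:R <= eta * n%:R /\ eta * n%:R < k%:R + 1.
  have /andP := floor_itv (eta * n%:R); rewrite kE => -[h1 h2]; split=> //.
  by move: h2; rewrite intrD.
(* With this step at most [2 delta n = k / 4] points move on average. Since [eta n < k + 1 <= 2 k],
   [delta] is comparable to [eta]. *)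
pose delta : R := k%:R / (8 * n%:R).
have delta0 : 0 < delta by rewrite divr_gt0 ?mulr_gt0//; lra.
have kdelta : k%:R = 8 * delta * n%:R by rewrite /delta; field; rewrite gt_eqF.
have delta_eta : 8 * delta <= eta by rewrite -(ler_pM2r n0) -kdelta.
have eta_delta : eta <= 16 * delta.
  by rewrite -(ler_pM2r n0); move: kdelta fl2 k1; lra.
rewrite leNgt; apply/negP => small.
have s2P mu : (dataE mu (fun X => Sens f eta X ^+ 2) <= ((delta / 4) ^+ 2)%:E)%E.
  apply: sqrte_lt; first lra.
  have lt1 : (ES2 f eta mu < (1 / 64 * eta)%:E)%E.
    by apply: le_lt_trans small; apply: ereal_sup_ubound; exists mu.
  by apply: lt_le_trans lt1 _; rewrite lee_fin; lra.
pose B := C_MSE * d%:R / n%:R.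
have fB mu : (dataE mu (fun X => ((l2dist (f X) mu) ^+ 2)%:E) <= B%:E)%E.
  by apply: le_trans fMSE; apply: ereal_sup_ubound; exists mu.
have dR : 0 < d%:R :> R by rewrite ltr0n.
have B0 : 0 <= B by rewrite divr_ge0 ?mulr_ge0 ?ltW.
(* Chosen so that [a K = delta / 4]. *)
pose a := delta / (4 * K).
have K0 : 0 < K by lra.
have a0 : 0 < a by rewrite divr_gt0// mulr_gt0.
have delta12 : 0 < delta <= 1 / 2 by apply/andP; split; lra.
have t0 : 0 < delta / 4 by lra.
have ketan : (k%:Z <= Num.floor (eta * n%:R))%R by rewrite kE.
have := sensitivity_lower_bound f mf eta B delta _ (delta / 4) a k d1 B0 fB
  delta12 t0 a0 ketan s2P.
apply/negP; rewrite -ltNge.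
have tail : (1 + 2 * delta) ^+ n / 2 ^+ k / (2 * a) <= delta / 4.
  rewrite ler_pdivrMr; last exact: mulr_gt0.
  rewrite [leRHS](_ : _ = delta ^+ 2 / (8 * K)).
    by apply: tail_bound => //; lra.
  by rewrite /a; field; rewrite gt_eqF.
have aK : a * K = delta / 4 by rewrite /a; field; rewrite gt_eqF.
(* The dimension cancels: the error per coordinate is at most [C_MSE / n]. *)
have Bd : B / d%:R <= C_MSE.
  by rewrite /B mulrAC mulfK ?gt_eqF// ler_pdivrMr// ler_peMr ?ltW//.
have -> : (delta / 4) ^+ 2 / (2 * (delta / 4)) = delta / 8.
  by field; rewrite gt_eqF.
have aB : 6 * a * (B / d%:R) <= 6 * a * C_MSE by rewrite ler_wpM2l// mulr_ge0// ltW.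
have d2 : delta ^+ 2 <= 1 by nra.
have ad2 : a * delta ^+ 2 <= a by rewrite -[leRHS]mulr1 ler_wpM2l ?(ltW a0).
(* The bound totals at most [delta / 8 + delta / 8 + delta / 4 + delta / 4], which is less than
   [delta]. *)
by move: aK; rewrite /K; lra.
Qed.
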